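(* Let $n,k,l$ be three integers with $n\geq 1$, $k\geq 2$ and $0\leq l\leq k-2$. The function $S\mapsto Tuple(S)$ is well-defined for the pair $(k,l)$, and it is a bijection between the set of $(k,l)$-threshold sequences of length $n$ and the set of ordered $(l+1)$-tuples of $k$-ary trees whose total number of internal nodes is $n$.
   Context: A $k$-ary tree ($k\ge 2$) is a rooted tree in which each internal node has exactly $k$ children, ordered from left to right. It is either trivial (a unique node, which is not internal; denoted $\lambda$) or consists of an internal root node and $k$ ordered $k$-ary subtrees. Two $k$-ary trees are equal iff both are trivial, or both are non-trivial with the same subtrees in the same order. A $k$-ary tree with $m$ internal nodes has $mk+1$ nodes. A $(k,l)$-threshold sequence of length $n$ is a strictly increasing sequence $S=(s_1s_2\ldots s_n)$ of integers such that $ki\leq s_i\leq kn+l$ for all $1\le i\le n$. It is a proper $(k,l')$-threshold sequence if it is a $(k,l')$-threshold sequence with $s_n=kn+l'$; thus each $(k,l)$-threshold sequence of length $n$ is a proper $(k,l')$-threshold sequence for the unique $l'=s_n-kn\in\{0,\ldots,l\}$. For $p\le q$, $S[p,q]$ denotes $(s_p s_{p+1}\ldots s_q)$. For an integer $w$, a $k$-ary $w$-tree is a $k$-ary tree $A$ whose nodes are labeled so that a breadth-first traversal of $A$ (level by level, left to right) gives the labels $w,w-1,\ldots,w-mk$ in this order, where $m$ is the number of internal nodes of $A$. The cut index of a $(k,l)$-threshold sequence $S$ of length $n$ is the largest index $i$ with $1\le i<n$ such that $s_i<s_n-(n-i)k$, if such an index exists, and is $0$ otherwise. The collection $Forest(S)$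 is defined recursively, starting from the empty collection. Let $i$ be the cut index of $S$. (1) Let $A_S^1$ be the $k$-ary $s_n$-tree whose internal nodes, in breadth-first order, are the nodes labeled $s_n,s_{n-1},\ldots,s_{i+1}$; add $A_S^1$ to $Forest(S)$, with its labels discarded. (2) If $i\neq 0$, let $Q=S[1,i]$ and add $Forest(Q)$ to $Forest(S)$. Write $Forest(S)=\{A_S^1,\ldots,A_S^t\}$ in order of computation, and let $Q_1=S,Q_2,\ldots,Q_t$ be the successive sequences (each $Q_{p+1}$ being the prefix of $Q_p$ ending at the cut index of $Q_p$), where $A_S^p$ is the tree produced by step (1) applied to $Q_p$. For $1\le p\le t$, let $l_p$ be the unique integer such that $Q_p$ is a proper $(k,l_p)$-threshold sequence. Then $Tuple(S)$ is the $(l+1)$-tuple containing $A_S^p$ in position $l_p+1$ for $1\le p\le t$, and the trivial tree $\lambda$ in each remaining position. (Well-definedness means that these trees exist and that the positions $l_p+1$ are pairwise distinct elements of $\{1,\ldots,l+1\}$.) *)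

(* Defs.v *)
From HB Require Import structures.
From mathcomp Require Import all_boot all_order all_algebra.
From mathcomp Require Import boolp classical_sets functions.

Set Implicit Arguments.
Unset Strict Implicit.
Unset Printing Implicit Defensive.

Import Order.TTheory GRing.Theory Num.Theory.
Local Open Scope ring_scope.

(* The children are indexed from left to right by 'I_k. *)
Inductive ktree (k : nat) : Type :=
  | Trivial
  | Node of {ffun 'I_k -> ktree k}.

Arguments Trivial {k}.

(* Needed by [xget] below. *)
HB.instance Definition _ (k : nat) := gen_eqMixin (ktree k).
HB.instance Definition _ (k : nat) := gen_choiceMixin (ktree k).

Section Trees.
Variable k : nat.
Implicit Types A : ktree k.

Fixpoint num_internal A : nat :=
  if A is Node f then (\sum_(i < k) num_internal (f i)).+1 else 0%N.

(* A node is represented by its address: the sequence of child indices on the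
   path leading to it from the root. *)
Fixpoint is_internal A (a : seq 'I_k) : bool :=
  match A, a with
  | Trivial, _ => false
  | Node _, [::] => true
  | Node f, i :: b => is_internal (f i) b
  end.

Fixpoint level A (d : nat) : seq (seq 'I_k) :=
  match d, A with
  | 0%N, _ => [:: [::]]
  | d'.+1, Trivial => [::]
  | d'.+1, Node f => [seq i :: a | i <- enum 'I_k, a <- level (f i) d']
  end.

(* The depth of a node is at most the number of internal nodes, so that no
   level is missed. *)
Definition breadth_first A : seq (seq 'I_k) :=
  flatten [seq level A d | d <- iota 0 (num_internal A).+1].

Definition is_wtree (w : int) A (lab : seq 'I_k -> int) : Prop :=
  [seq lab a | a <- breadth_first A] =
  [seq w - j%:Z | j <- iota 0 (num_internal A * k).+1].

Definition internal_labels A (lab : seq 'I_k -> int) : seq int :=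
  [seq lab a | a <- breadth_first A & is_internal A a].

End Trees.

Section Thresholds.
Variable k : nat.
Implicit Types (S Q : seq int) (l : int).

(* [S`_i] is s_(i+1): sequences are indexed from 0 here. *)
Definition threshold l (n : nat) S : bool :=
  [&& size S == n,
      sorted <%R S &
      [forall i : 'I_n, (k * i.+1)%:Z <= S`_i <= (k * n)%:Z + l]].

Definition proper_threshold l (n : nat) S : bool :=
  threshold l n S && (last 0 S == (k * n)%:Z + l).

(* An empty maximum is 0. *)
Definition cut_index S : nat :=
  let n := size S in
  \max_(1 <= i < n | S`_i.-1 < last 0 S - ((n - i) * k)%:Z) i.

(* The sequence Q_1 = S, Q_2, ..., Q_t. The cut index of a nonempty sequence is
   smaller than its length, hence [size S] is enough fuel. *)
Fixpoint cut_prefixes_rec (fuel : nat) S : seq (seq int) :=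
  if fuel is fuel'.+1 then
    S :: (if cut_index S == 0%N then [::]
          else cut_prefixes_rec fuel' (take (cut_index S) S))
  else [::].

Definition cut_prefixes S : seq (seq int) := cut_prefixes_rec (size S) S.

(* [A] is a tree produced by step (1) of the computation of Forest(Q). *)
Definition is_first_tree Q (A : ktree k) : Prop :=
  exists lab : seq 'I_k -> int,
    is_wtree (last 0 Q) A lab /\
    internal_labels A lab = rev (drop (cut_index Q) Q).

(* The default value [Trivial] is irrelevant as soon as such a tree exists,
   see [ForestTuple_well_defined]. *)
Definition first_tree Q : ktree k :=
  xget Trivial [set A | is_first_tree Q A]%classic.

Definition Forest S : seq (ktree k) :=
  [seq first_tree Q | Q <- cut_prefixes S].

(* The integer l' such that Q is a proper (k,l')-threshold sequence. *)
Definition excess Q : int := last 0 Q - (k * size Q)%:Z.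

(* Coordinate j (from 0) is A_S^p if l_p = j for some p; otherwise [index]
   is out of bounds and the coordinate is the trivial tree. *)
Definition ForestTuple (l : nat) S : l.+1.-tuple (ktree k) :=
  [tuple nth Trivial (Forest S)
           (index (j : nat)%:Z [seq excess Q | Q <- cut_prefixes S]) | j < l.+1].

Definition ForestTuple_well_defined (l n : nat) : Prop :=
  forall S, threshold l n S ->
  [/\ forall Q, Q \in cut_prefixes S -> exists! A : ktree k, is_first_tree Q A,
      forall Q, Q \in cut_prefixes S ->
        (forall l' : int, proper_threshold l' (size Q) Q <-> l' = excess Q) /\
        0 <= excess Q <= l%:Z
    & uniq [seq excess Q | Q <- cut_prefixes S]].

End Thresholds.

(* Main.v *)
(* A k-ary tree is determined by the positions 0 = d_0 < d_1 < ... of its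
   internal nodes in breadth-first order, and an increasing sequence arises in
   this way iff d_r <= r k for all r: the r-th internal node is one of the
   r k + 1 nodes that are the root or children of earlier internal nodes.  With
   d_r = s_n - s_(n-r), this is exactly the condition satisfied by the part of S
   above its cut index, so the first tree exists and is unique.

   In terms of the excess of the prefixes of S (last term minus k times the
   length), the cut index is the length of the longest proper prefix with a
   smaller excess.  Hence the excesses l_1 > l_2 > ... decrease strictly and S is
   recovered by appending, for j = 0, ..., l, the block of the tree in position
   j, shifted so that the resulting prefix has excess j. *)
Require Import Defs.
From mathcomp Require Import all_boot all_order all_algebra.
From mathcomp Require Import boolp classical_sets functions.
From mathcomp Require Import zify.

Set Implicit Arguments.
Unset Strict Implicit.
Unset Printing Implicit Defensive.

Import Order.TTheory GRing.Theory Num.Theory.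

(** * Positions of the true letters of a Boolean word *)

Definition true_positions (b : seq bool) : seq nat := mask b (iota 0 (size b)).

Lemma sorted_true_positions b : sorted ltn (true_positions b).
Proof. exact: (subseq_sorted ltn_trans (mask_subseq _ _) (iota_ltn_sorted _ _)). Qed.

Lemma size_true_positions b : size (true_positions b) = count id b.
Proof. by rewrite size_mask ?size_iota. Qed.

Lemma mem_true_positions b j : (j \in true_positions b) = nth false b j.
Proof.
rewrite in_mask ?iota_uniq // mem_iota /= add0n.
case: ltnP => [lt_jb|le_bj]; last by rewrite [RHS]nth_default.
have eq_j : nth 0 (iota 0 (size b)) j = j by rewrite nth_iota.
by rewrite -{1}eq_j index_uniq ?size_iota ?iota_uniq.
Qed.

Lemma true_positions_inj b b' :
  size b = size b' -> true_positions b = true_positions b' -> b = b'.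
Proof.
move=> eq_sz eq_pos; apply: (@eq_from_nth _ false) => // i _.
by rewrite -!mem_true_positions eq_pos.
Qed.

Lemma true_positions_mem (D : seq nat) (n : nat) :
  sorted ltn D -> {in D, forall x, x < n} ->
  true_positions [seq j \in D | j <- iota 0 n] = D.
Proof.
move=> sD ltDn; apply: (irr_sorted_eq ltn_trans ltnn) => //.
  exact: sorted_true_positions.
move=> x; rewrite mem_true_positions; case: (ltnP x n) => [ltxn|lenx].
  by rewrite (nth_map 0) ?size_iota // nth_iota.
rewrite nth_default ?size_map ?size_iota //; symmetry.
by apply: contraTF lenx => /ltDn; rewrite ltnNge.
Qed.

(** Turns the number of internal nodes read before [j], on which [bfs_valid] depends, into a
    statement about their positions. *)
Lemma count_true_positions b j :
  count (fun i => i < j) (true_positions b) = count id (take j b).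
Proof.
have [le_bj|/ltnW le_jb] := leqP (size b) j.
  rewrite take_oversize // -size_true_positions; apply/eqP.
  rewrite -all_count; apply/allP => x /mem_mask; rewrite mem_iota => /andP[_].
  by move/leq_trans; apply.
rewrite /true_positions -{1}(cat_take_drop j b) -(subnKC le_jb) iotaD.
rewrite mask_cat ?size_takel ?size_iota // count_cat add0n.
have /eqP-> : count (fun i => i < j) (mask (take j b) (iota 0 j)) ==
              count id (take j b).
  rewrite -(@size_mask _ _ (iota 0 j)) ?size_takel ?size_iota //.
  rewrite -all_count; apply/allP => x /mem_mask; rewrite mem_iota.
  by case/andP.
rewrite [X in _ + X](_ : _ = 0) ?addn0 //.
apply/eqP; rewrite -leqn0 leqNgt -has_count.
apply/hasPn => x /mem_mask; rewrite mem_iota => /andP[+ _].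
by rewrite -leqNgt.
Qed.

(** * Breadth-first words of forests, read level by level *)

Section BreadthFirst.
Variable k : nat.
Implicit Types (A B : ktree k) (F G : seq (ktree k)).

Definition nontrivial A : bool := if A is Node _ then true else false.

Definition children A : seq (ktree k) :=
  if A is Node f then [seq f i | i <- enum 'I_k] else [::].

Definition next_level F : seq (ktree k) := flatten (map children F).

Definition total F : nat := \sum_(A <- F) num_internal A.

(** A relation, because [next_level F] is not a subterm of [F]. [BfsLevel] also applies to the empty
    forest, where it adds no letter. *)
Inductive bfs_word : seq (ktree k) -> seq bool -> Prop :=
  | BfsNil : bfs_word [::] [::]
  | BfsLevel F b : bfs_word (next_level F) b -> bfs_word F (map nontrivial F ++ b).

(* A node is read at position [j] only if it has been announced before, as one
   of the [c] roots or as a child of an internal node at an earlier position. *)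
Definition bfs_valid (c : nat) (b : seq bool) : Prop :=
  size b = c + k * count id b /\
  forall j, j < size b -> j < c + k * count id (take j b).

Lemma total_next_level F : total F = count id (map nontrivial F) + total (next_level F).
Proof.
rewrite /total /next_level; elim: F => [|A F IH] /=; first by rewrite !big_nil.
rewrite big_cons big_cat IH; case: A => [|f] /=; first by rewrite big_nil.
have -> : \sum_(B <- [seq f i | i <- enum 'I_k]) num_internal B =
          \sum_(i < k) num_internal (f i) by rewrite big_map big_enum.
by rewrite add1n !addSn addnCA.
Qed.

Lemma size_next_level F : size (next_level F) = k * count id (map nontrivial F).
Proof.
rewrite /next_level; elim: F => [|A F IH] /=; first by rewrite muln0.
rewrite size_cat IH; case: A => [|f] //=.
by rewrite size_map size_enum_ord mulnDr muln1.
Qed.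

Lemma children_inj A B :
  nontrivial A = nontrivial B -> children A = children B -> A = B.
Proof.
case: A B => [|f] [|g] //= _ eq_fg; congr Node; apply/ffunP => i.
by have /eq_in_map/(_ i) := eq_fg; rewrite mem_enum; apply.
Qed.

Lemma next_level_inj F G :
  map nontrivial F = map nontrivial G -> next_level F = next_level G -> F = G.
Proof.
rewrite /next_level; elim: F G => [|A F IH] [|B G] //= [eqAB eqFG] /eqP.
rewrite eqseq_cat; last first.
  by case: A B eqAB => [|f] [|g] //= _; rewrite !size_map.
by case/andP => /eqP/children_inj-> // /eqP/IH->.
Qed.

(** Each [true] takes the next [k] trees of [G] as its children; a [false] takes none. *)
Lemma next_level_surj (b : seq bool) G :
  size G = k * count id b ->
  exists F, map nontrivial F = b /\ next_level F = G.
Proof.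
elim: b G => [|[] b IH] G /=; first by rewrite muln0 => /size0nil->; exists [::].
  rewrite mulnDr muln1 => szG.
  have [|F [Fb FG]] := IH (drop k G); first by rewrite size_drop szG addKn.
  exists (Node [ffun i : 'I_k => nth Trivial G i] :: F).
  split => /=; first by rewrite Fb.
  rewrite /next_level /= -/(next_level F) FG -[RHS](cat_take_drop k); congr cat.
  have le_kG : k <= size G by rewrite szG leq_addr.
  apply: (@eq_from_nth _ Trivial).
    by rewrite size_map size_enum_ord size_takel.
  move=> i; rewrite size_map size_enum_ord => lt_ik.
  rewrite (nth_map (Ordinal lt_ik)) ?size_enum_ord // ffunE nth_enum_ord //.
  by rewrite nth_take.
by move/IH => [F [Fb FG]]; exists (Trivial :: F); rewrite /= Fb.
Qed.

(** The number of roots tells where the first level ends in the word, and its [true] letters give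
    the number of roots of the next forest, so the levels are decoded one by one. *)
Lemma bfs_word_inj F G b :
  size F = size G -> bfs_word F b -> bfs_word G b -> F = G.
Proof.
move=> + Fb; elim: Fb G => [|{b}F b Fb IH] G; first by move/esym/size0nil.
move=> szFG; move eq_b: (_ ++ b) => b' Gb'.
case: G b' / Gb' szFG eq_b => [/size0nil-> //|G b' Gb' szFG /eqP].
rewrite eqseq_cat ?size_map // => /andP[/eqP eqFG /eqP eqb].
apply: next_level_inj => //; apply: IH; last by rewrite eqb.
by rewrite !size_next_level eqFG.
Qed.

Lemma count_bfs_word F b : bfs_word F b -> count id b = total F.
Proof.
by elim=> [|{b}F b _ IH]; rewrite ?/total ?big_nil // count_cat IH -total_next_level.
Qed.

Lemma bfs_word_valid F b : bfs_word F b -> bfs_valid (size F) b.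
Proof.
elim=> [|{b}F b Fb [szb IH]]; first by split; rewrite //= muln0.
split=> [|j]; rewrite size_cat size_map.
  by rewrite szb size_next_level count_cat; lia.
rewrite take_cat size_map => lt_j; case: (ltnP j (size F)) => [lt_jF|le_Fj].
  exact: ltn_addr.
have /IH : j - size F < size b by lia.
by rewrite size_next_level count_cat; lia.
Qed.

Lemma bfs_word_nil b : bfs_word [::] b -> b = [::].
Proof.
case/bfs_word_valid; case: b => // x b _ /(_ 0 isT).
by rewrite take0 muln0.
Qed.

Lemma bfs_word_uniq F b b' : bfs_word F b -> bfs_word F b' -> b = b'.
Proof.
move=> Fb; elim: Fb b' => [|{b}F b Fb IH] b'; first by move/bfs_word_nil.
move eq_F: F => F' F'b'; case: F' b' / F'b' eq_F => [|F' b' Gb' eq_F]; last first.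
  by rewrite -eq_F; congr cat; apply: IH; rewrite eq_F.
(* The empty forest also arises from [BfsLevel] with an empty level; [IH] shows that the rest is
   empty. *)
by move=> F0; subst F; rewrite (IH [::] BfsNil).
Qed.

(** The first [c] letters form the level of the roots; the rest is shorter and valid for the number
    of their children. For [c = 0], validity at position 0 forces the empty word. *)
Lemma valid_bfs_word c b : bfs_valid c b -> exists2 F, size F = c & bfs_word F b.
Proof.
have [m] := ubnP (size b); elim: m c b => // m IH c b lt_bm [szb vb].
have [c0|c_gt0] := posnP c.
  exists [::] => //; case: b szb vb {lt_bm} => [|x b] _ vb; first exact: BfsNil.
  by have := vb 0 isT; rewrite take0 c0 muln0.
have le_cb : c <= size b by rewrite szb leq_addr.
have cnt : count id b = count id (take c b) + count id (drop c b).
  by rewrite -count_cat cat_take_drop.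
have [||G szG Gb] := IH (k * count id (take c b)) (drop c b).
- by rewrite size_drop; lia.
- split=> [|j]; rewrite size_drop; first by lia.
  rewrite ltn_subRL => /vb; rewrite take_drop (addnC j c); set t := take (c + j) b.
  have -> : count id t = count id (take c b) + count id (drop c t).
    rewrite -{1}(cat_take_drop c t) count_cat /t take_takel //; exact: leq_addr.
  lia.
have [F [Fb FG]] := next_level_surj szG.
exists F; first by rewrite -(size_map nontrivial) Fb size_takel.
by rewrite -(cat_take_drop c b) -Fb; apply: BfsLevel; rewrite FG.
Qed.

(** * The traversal of a single tree as a breadth-first word *)

Definition bfs_bits A : seq bool := [seq is_internal A a | a <- breadth_first A].

Definition level_bits F (d : nat) : seq bool :=
  flatten [seq [seq is_internal A a | a <- level A d] | A <- F].

Lemma level_bits0 F : level_bits F 0 = map nontrivial F.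
Proof. by rewrite /level_bits; elim: F => //= A F ->; case: A. Qed.

Lemma level_bitsS F d : level_bits F d.+1 = level_bits (next_level F) d.
Proof.
rewrite /level_bits /next_level; elim: F => //= A F ->; rewrite map_cat flatten_cat.
congr cat; case: A => [|f] //=; rewrite map_flatten; congr flatten.
by rewrite -!map_comp; apply: eq_map => i /=; rewrite -map_comp.
Qed.

(** A level containing an internal node lowers [total]; after a level without one, the forest is
    empty and later levels add nothing. *)
Lemma bfs_word_level_bits F n :
  (total F < n) -> bfs_word F (flatten [seq level_bits F d | d <- iota 0 n]).
Proof.
elim: n F => // n IH F lt_Fn /=; rewrite level_bits0; apply: BfsLevel.
rewrite (iotaDl 1 0) -map_comp.
rewrite (eq_map (_ : _ =1 level_bits (next_level F))); last exact: level_bitsS.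
have [cnt0|cnt_gt0] := posnP (count id (map nontrivial F)); last first.
  by apply: IH; move: lt_Fn; rewrite total_next_level; lia.
have -> : next_level F = [::] by apply: size0nil; rewrite size_next_level cnt0 muln0.
suff -> : flatten [seq level_bits [::] d | d <- iota 0 n] = [::] by exact: BfsNil.
by elim: (iota 0 n).
Qed.

Lemma bfs_word_bits A : bfs_word [:: A] (bfs_bits A).
Proof.
rewrite /bfs_bits /breadth_first map_flatten -map_comp.
have /bfs_word_level_bits : total [:: A] < (num_internal A).+1.
  by rewrite /total big_seq1.
by under eq_map do rewrite /level_bits /= cats0.
Qed.

Lemma count_bfs_bits A : count id (bfs_bits A) = num_internal A.
Proof. by rewrite (count_bfs_word (bfs_word_bits A)) /total big_seq1. Qed.

Lemma size_bfs_bits A : size (bfs_bits A) = (num_internal A * k).+1.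
Proof.
by have [-> _] := bfs_word_valid (bfs_word_bits A); rewrite count_bfs_bits mulnC.
Qed.

Lemma size_level A d : {in level A d, forall a, size a = d}.
Proof.
elim: d A => [|d IH] [|f] a //=; rewrite ?inE; try by move/eqP->.
by case/allpairsPdep => i [b [_ /IH<- ->]].
Qed.

Lemma uniq_level A d : uniq (level A d).
Proof.
elim: d A => [|d IH] [|f] //=; apply: allpairs_uniq_dep => //; first exact: enum_uniq.
by move=> [i a] [j b] _ _ /= [-> ->].
Qed.

(** Addresses in different levels have different lengths. *)
Lemma uniq_breadth_first A : uniq (breadth_first A).
Proof.
rewrite /breadth_first.
have -> : [seq level A d | d <- iota 0 (num_internal A).+1] =
          [seq [seq id a | a <- level A d] | d <- iota 0 (num_internal A).+1].
  by apply: eq_map => d; rewrite map_id.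
apply: allpairs_uniq_dep; first exact: iota_uniq.
  by move=> d _; apply: uniq_level.
move=> [d a] [d' a'] /allpairsPdep[x [y [_ xy ->]]].
case/allpairsPdep=> [x' [y' [_ xy' ->]]] /= eqy.
by move: (size_level xy) (size_level xy'); rewrite eqy => <- <-.
Qed.

(** * Trees encoded by the positions of their internal nodes *)

Definition code A : seq nat := true_positions (bfs_bits A).

Lemma size_code A : size (code A) = num_internal A.
Proof. by rewrite size_true_positions count_bfs_bits. Qed.

Lemma code_trivial : code Trivial = [::].
Proof. by apply: size0nil; rewrite size_code. Qed.

(** The length of the code gives the length of the word, so the positions determine the word, and
    the word determines the tree. *)
Lemma code_inj : injective code.
Proof.
move=> A B eqAB; have szAB : size (bfs_bits A) = size (bfs_bits B).
  by rewrite !size_bfs_bits -!size_code eqAB.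
have eq_bits := true_positions_inj szAB eqAB.
have := bfs_word_bits B; rewrite -eq_bits => /(bfs_word_inj _ (bfs_word_bits A)).
by case/(_ erefl).
Qed.

Lemma sorted_code A : sorted ltn (code A).
Proof. exact: sorted_true_positions. Qed.

(** Exactly [r] internal nodes precede the one at position d_r, so validity at d_r reads d_r < 1 + k
    r. *)
Lemma nth_code_le A r : r < num_internal A -> nth 0 (code A) r <= r * k.
Proof.
rewrite -size_code => lt_r; have [_ vA] := bfs_word_valid (bfs_word_bits A).
have lt_b : nth 0 (code A) r < size (bfs_bits A).
  rewrite ltnNge; have := mem_nth 0 lt_r; rewrite mem_true_positions.
  by apply: contraTN => /(nth_default false)->.
have := vA _ lt_b; rewrite -count_true_positions -/(code A).
rewrite (count_lt_nth 0 (sorted_code A) lt_r) /= add1n ltnS mulnC; exact.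
Qed.

Lemma code_surj (D : seq nat) :
  sorted ltn D -> (forall r, r < size D -> nth 0 D r <= r * k) ->
  exists A, code A = D.
Proof.
move=> sD leD; set m := size D.
pose b := [seq j \in D | j <- iota 0 (m * k).+1].
have posb : true_positions b = D.
  apply: true_positions_mem => // x /(nthP 0)[r lt_r <-].
  by rewrite ltnS (leq_trans (leD r lt_r)) // leq_mul2r ltnW ?orbT.
have cntb : count id b = m by rewrite -size_true_positions posb.
have [|[|A []] // _ Ab] := @valid_bfs_word 1 b.
  split=> [|j]; first by rewrite cntb size_map size_iota mulnC.
  rewrite size_map size_iota -count_true_positions posb => lt_j.
  (* Here [r] entries of [D] lie below [j]. If [r = m], the length of [b] gives the bound; otherwise
     j <= d_r <= r k. *)
  set r := count _ _; have := count_size (fun i => i < j) D.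
  rewrite -/r -/m leq_eqVlt add1n ltnS mulnC => /predU1P[-> //|lt_r].
  apply: leq_trans (leD r lt_r); rewrite leqNgt; apply/negP => lt_rj.
  suff : r.+1 <= r by rewrite ltnn.
  rewrite -(count_le_nth 0 sD lt_r); apply: sub_count => i /=.
  by rewrite leEnat => /leq_ltn_trans; apply.
by exists A; rewrite /code (bfs_word_uniq (bfs_word_bits A) Ab).
Qed.
End BreadthFirst.

Local Open Scope ring_scope.

Lemma last_take (S : seq int) i :
  (0 < i <= size S)%N -> last 0 (take i S) = S`_i.-1.
Proof.
by case: i => // i lt_iS; rewrite -nth_last size_takel // nth_take.
Qed.

Lemma sorted_le_last (S : seq int) :
  sorted <%R S -> {in S, forall x, x <= last 0 S}.
Proof.
move=> sS x /(nthP 0)[i lt_iS <-]; rewrite -nth_last.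
by rewrite lt_sorted_leq_nth ?inE //; move: lt_iS; case: (size S) => //.
Qed.

(** * The tree of step (1) and the cut index *)

Section Cutting.
Variable k : nat.
Implicit Types (S Q : seq int) (A : ktree k) (T : seq (ktree k)).

Lemma internal_labels_code (w : int) A lab :
  is_wtree w A lab -> internal_labels A lab = [seq w - d%:Z | d <- code A].
Proof.
rewrite /is_wtree /internal_labels filter_mask -/(bfs_bits A) map_mask => ->.
by rewrite -map_mask /code /true_positions size_bfs_bits.
Qed.

Lemma is_wtree_exists (w : int) A : exists lab, is_wtree w A lab.
Proof.
exists (fun a => w - (index a (breadth_first A))%:Z).
rewrite /is_wtree -size_bfs_bits /bfs_bits size_map.
apply: (@eq_from_nth _ 0) => [|i]; rewrite !size_map ?size_iota // => lt_i.
rewrite (nth_map [::]) // index_uniq ?uniq_breadth_first //.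
by rewrite (nth_map 0%N) ?size_iota // nth_iota.
Qed.

(** A suitable labelling always exists and forces the internal labels, so only [code A] matters. *)
Lemma is_first_treeP Q A :
  is_first_tree Q A <->
  rev (drop (cut_index k Q) Q) = [seq last 0 Q - d%:Z | d <- code A].
Proof.
split=> [[lab [/internal_labels_code <- <-]] //|eqQ].
have [lab labP] := is_wtree_exists (last 0 Q) A; exists lab; split=> //.
by rewrite (internal_labels_code labP).
Qed.

Lemma is_first_tree_inj Q A B : is_first_tree Q A -> is_first_tree Q B -> A = B.
Proof.
move=> /is_first_treeP eqA /is_first_treeP; rewrite eqA => eqAB; apply: code_inj.
by apply: (inj_map _ eqAB) => x y; lia.
Qed.

Lemma first_treeE Q A : is_first_tree Q A -> first_tree k Q = A.
Proof.
by move=> QA; apply: xget_unique => // B QB; apply: is_first_tree_inj QB QA.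
Qed.

(** Subtracting k i on both sides turns the test in [cut_index] into a comparison of excesses. *)
Lemma lt_excess_take S i : (0 < i <= size S)%N ->
  (S`_i.-1 < last 0 S - ((size S - i) * k)%:Z) =
  (excess k (take i S) < excess k S).
Proof.
move=> lt_i; rewrite /excess last_take // size_takel; last by case/andP: lt_i.
have : (i * k <= size S * k)%N by rewrite leq_mul2r; lia.
rewrite mulnBl; lia.
Qed.

Definition is_cut S c : Prop :=
  [/\ (c < size S)%N,
      (0 < c)%N -> excess k (take c S) < excess k S &
      forall i, (c < i <= size S)%N -> excess k S <= excess k (take i S)].

Lemma cut_indexP S : S != [::] -> is_cut S (cut_index k S).
Proof.
move=> S_neq0; have S_gt0 : (0 < size S)%N by case: (S) S_neq0.
have : [/\ (cut_index k S < size S)%N &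
  (0 < cut_index k S)%N -> excess k (take (cut_index k S) S) < excess k S].
  rewrite /cut_index big_nat_cond.
  elim/big_ind: _ => [//|x y Px Py|i /andP[/andP[i_gt0 lt_i]]].
    by rewrite /maxn; case: ifP.
  by rewrite lt_excess_take // i_gt0 ltnW.
move=> [lt_c c_lt]; split=> // i /andP[lt_ci]; rewrite leq_eqVlt.
case/predU1P => [->|lt_iS]; first by rewrite take_size.
rewrite leNgt -lt_excess_take; last by lia.
have i_gt0 := leq_ltn_trans (leq0n _) lt_ci.
apply: contraL lt_ci => lt_i; rewrite -leqNgt /cut_index.
apply: (@leq_bigmax_seq _ _ _ id) => //; rewrite mem_index_iota; exact/andP.
Qed.

Lemma is_cut_inj S c c' : is_cut S c -> is_cut S c' -> c = c'.
Proof.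
wlog lt_cc' : c c' / (c < c')%N => [IH|].
  by case: (ltngtP c c') => // lt Sc Sc'; [|symmetry]; apply: IH.
move=> [_ _ ge_c] [lt_c' /(_ (leq_ltn_trans (leq0n _) lt_cc')) lt_e _].
by have := ge_c c'; rewrite lt_cc' ltnW // leNgt lt_e => /(_ isT).
Qed.

Lemma cut_indexE S c : is_cut S c -> cut_index k S = c.
Proof.
move=> Sc; have S_neq0 : S != [::] by case: Sc; case: (S).
exact: is_cut_inj (cut_indexP S_neq0) Sc.
Qed.

Lemma first_tree_exists S :
  sorted <%R S -> S != [::] -> is_first_tree S (first_tree k S).
Proof.
move=> sS S_neq0; suff [A SA] : exists A, is_first_tree S A.
  by rewrite (first_treeE SA).
have [lt_c _ ge_c] := cut_indexP S_neq0; set c := cut_index k S in lt_c ge_c.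
have le_last := sorted_le_last sS.
have le_drop : {in drop c S, forall x, x <= last 0 S}.
  by move=> x /mem_drop; apply: le_last.
(* The entries are d_r = s_n - s_(n-r); the absolute value only moves them to [nat], since s_n is
   the maximum. *)
pose D := [seq `|(last 0 S - s)%R|%N | s <- rev (drop c S)].
have [||A AD] := @code_surj k D.
- rewrite /D sorted_map rev_sorted.
  apply: (@sub_in_sorted _ (fun x => x <= last 0 S) <%R).
  + by move=> x y; rewrite /in_mem /=; lia.
  + exact/allP.
  + exact: drop_sorted.
- move=> r; rewrite size_map size_rev size_drop => lt_rD.
  have lt_r : (r < size S - c)%N := lt_rD.
  (* The cut condition for the prefix of length n - r gives d_r <= r k. *)
  have /ge_c : (c < size S - r <= size S)%N by lia.
  rewrite (nth_map 0) ?size_rev ?size_drop // nth_rev ?size_drop // nth_drop.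
  rewrite /excess last_take ?size_takel; try lia.
  have -> : (size S - r).-1 = (c + (size S - c - r.+1))%N by lia.
  have lt_iS : (c + (size S - c - r.+1) < size S)%N by lia.
  have := le_last _ (mem_nth 0 lt_iS).
  have : (k * r <= k * size S)%N by rewrite leq_mul2l; lia.
  rewrite mulnBr; move: (S`_(_ + _)) (last 0 S) (k * size S)%N; lia.
exists A; apply/is_first_treeP; rewrite -/c AD /D -map_comp map_id_in //.
by move=> x; rewrite mem_rev => /le_drop /=; lia.
Qed.

(** * The coordinates of the tuple along successive cuts *)

Definition coordinate S (j : nat) : ktree k :=
  nth Trivial (Forest k S) (index j%:Z [seq excess k Q | Q <- cut_prefixes k S]).

Lemma cut_prefixes_fuel S f f' :
  (size S <= f)%N -> (size S <= f')%N -> S != [::] ->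
  cut_prefixes_rec k f S = cut_prefixes_rec k f' S.
Proof.
elim: f f' S => [|f IH] [|f'] S; try by case: S.
move=> le_Sf le_Sf' S_neq0 /=; case: eqP => // /eqP c_neq0; congr cons.
have [lt_c _ _] := cut_indexP S_neq0.
by apply: IH; rewrite -?size_eq0 size_takel ?(ltnW lt_c) //; lia.
Qed.

(** A zero cut index leaves the empty prefix, whose list of cut prefixes is empty, so one equation
    covers both branches. *)
Lemma cut_prefixes_cons S : S != [::] ->
  cut_prefixes k S = S :: cut_prefixes k (take (cut_index k S) S).
Proof.
move=> S_neq0; have [lt_c _ _] := cut_indexP S_neq0.
rewrite {1}/cut_prefixes; case eq_n: (size S) lt_c => [|n] //= lt_c; congr cons.
case: eqP => [->|/eqP c_neq0]; first by rewrite take0.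
by apply: cut_prefixes_fuel; rewrite -?size_eq0 size_takel ?eq_n ?(ltnW lt_c) //.
Qed.

Lemma coordinate_nil j : coordinate [::] j = Trivial.
Proof. by []. Qed.

Lemma coordinate_cons S j : S != [::] ->
  coordinate S j = if excess k S == j%:Z then first_tree k S
                   else coordinate (take (cut_index k S) S) j.
Proof.
by move=> S_neq0; rewrite /coordinate /Forest cut_prefixes_cons //=; case: eqP.
Qed.

(* [L] is l + 1, so that an induction on [L] starts from the empty sequence. *)
Definition admissible (L : nat) S : Prop :=
  [/\ sorted <%R S,
      forall i, (0 < i <= size S)%N -> 0 <= excess k (take i S) &
      S != [::] -> excess k S < L%:Z].

Lemma excess_ge0 L S : admissible L S -> S != [::] -> 0 <= excess k S.
Proof.
case=> _ + _ S_neq0 => /(_ (size S)); rewrite take_size; apply.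
by rewrite leqnn lt0n size_eq0 S_neq0.
Qed.

Lemma admissible_cut L L' S :
  admissible L S -> S != [::] -> excess k S <= L'%:Z ->
  admissible L' (take (cut_index k S) S).
Proof.
move=> [sS ge0 _] S_neq0 leL'; have [lt_c c_lt _] := cut_indexP S_neq0.
split=> [|i|]; first exact: take_sorted.
  rewrite size_takel ?(ltnW lt_c) // => /andP[i_gt0 le_ic].
  by rewrite take_takel //; apply: ge0; lia.
rewrite -size_eq0 size_takel ?(ltnW lt_c) // -lt0n => /c_lt.
by move/lt_le_trans; apply.
Qed.

Lemma coordinate_large L S j : admissible L S -> (L <= j)%N -> coordinate S j = Trivial.
Proof.
have [m] := ubnP (size S); elim: m S => // m IH S lt_Sm aS le_Lj.
have [->|S_neq0] := eqVneq S [::]; first exact: coordinate_nil.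
have [_ _ /(_ S_neq0) lt_eL] := aS; have [lt_c _ _] := cut_indexP S_neq0.
rewrite coordinate_cons //; case: eqP => [|_]; first by lia.
apply: IH => //; first by rewrite size_takel; lia.
by apply: admissible_cut aS S_neq0 _; apply: ltW.
Qed.

(** * The inverse map, concatenating shifted codes *)

Definition coordinates (L : nat) S : seq (ktree k) :=
  [seq coordinate S j | j <- rev (iota 0 L)].

Lemma coordinatesS L S : coordinates L.+1 S = coordinate S L :: coordinates L S.
Proof. by rewrite /coordinates -addn1 iotaD rev_cat. Qed.

(** The constant is the last term that gives excess [L] at length [N + size (code A)]; an internal
    root, at position 0, yields this term. *)
Definition block (L N : nat) A : seq int :=
  [seq (k * (N + size (code A)) + L)%:Z - d%:Z | d <- rev (code A)].

(* The trees are listed by decreasing position: the head of [A :: T] has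
   position [size T]. *)
Fixpoint join_trees T : seq int :=
  if T is A :: T' then
    join_trees T' ++ block (size T') (size (join_trees T')) A
  else [::].

Lemma size_join_trees T : size (join_trees T) = (\sum_(A <- T) num_internal A)%N.
Proof.
elim: T => [|A T IH] /=; first by rewrite big_nil.
by rewrite size_cat size_map size_rev size_code IH big_cons addnC.
Qed.

Lemma block_trivial L N : block L N Trivial = [::].
Proof. by rewrite /block code_trivial. Qed.

(** Either [S] is already admissible for [L], and position [L] holds the trivial tree, whose block
    is empty, or its excess is exactly [L], and the first tree accounts for the part of [S] above
    the cut. *)
Lemma join_coordinates L S : admissible L S -> join_trees (coordinates L S) = S.
Proof.
elim: L S => [|L IH] S aS.
  apply/esym/eqP; apply/negPn/negP => S_neq0; case: (aS) => _ _ /(_ S_neq0).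
  by rewrite ltNge (excess_ge0 aS).
rewrite coordinatesS /=; have [sS ge0 lt_eL] := aS.
have [aS'|] := pselect (admissible L S).
  by rewrite IH // (coordinate_large aS') // block_trivial cats0.
have [->|S_neq0 naS] := eqVneq S [::]; first by case; split=> // -[|i].
have ge_e : L%:Z <= excess k S by rewrite leNgt; apply/negP => lt_e; apply: naS.
have eq_e : excess k S = L by have := lt_eL S_neq0; lia.
(* Below position [L] only the cut prefix contributes. *)
have -> : coordinates L S = coordinates L (take (cut_index k S) S).
  apply/eq_in_map => j; rewrite mem_rev mem_iota => lt_j.
  by rewrite coordinate_cons // eq_e; case: eqP => //; lia.
have [lt_c _ _] := cut_indexP S_neq0.
rewrite IH; last by apply: admissible_cut aS S_neq0 _; rewrite eq_e.
rewrite coordinate_cons // eq_e eqxx.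
rewrite -[RHS](cat_take_drop (cut_index k S)); congr cat.
have /is_first_treeP SA := first_tree_exists sS S_neq0.
have szA : size (code (first_tree k S)) = (size S - cut_index k S)%N.
  by have := congr1 size SA; rewrite size_rev size_drop size_map => <-.
rewrite /block size_map size_rev size_iota szA size_takel ?(ltnW lt_c) //.
rewrite subnKC ?(ltnW lt_c) //.
rewrite map_rev -[RHS]revK SA; congr rev; apply: eq_map => d.
by move: eq_e; rewrite /excess; lia.
Qed.

(** * Appending the block of one nontrivial tree *)

Section AppendBlock.
Variables (L : nat) (Q : seq int) (A : ktree k).
Hypotheses (aQ : admissible L Q) (A_gt0 : (0 < num_internal A)%N).

Let S := Q ++ block L (size Q) A.

Lemma size_append_block : size S = (size Q + num_internal A)%N.
Proof. by rewrite size_cat size_map size_rev size_code. Qed.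

Lemma nth_append_block i : (size Q < i <= size S)%N ->
  S`_i.-1 = (k * size S + L)%:Z - (nth 0%N (code A) (size S - i))%:Z.
Proof.
rewrite size_append_block /S nth_cat /block size_code.
move: (size Q) => q lt_i; case: ltnP => [|_]; first by lia.
rewrite (nth_map 0%N) ?size_rev ?size_code; last by lia.
rewrite nth_rev ?size_code; last by lia.
by congr (_ - (nth _ _ _)%:Z); lia.
Qed.

Lemma last_append_block : last 0 S = (k * size S + L)%:Z.
Proof.
rewrite -nth_last nth_append_block; last by rewrite size_append_block; lia.
(* The bound d_r <= r k at r = 0 forces d_0 = 0. *)
rewrite subnn; have := nth_code_le A_gt0.
by rewrite mul0n leqn0 => /eqP->; rewrite subr0.
Qed.

Lemma excess_append_block : excess k S = L.
Proof. by rewrite /excess last_append_block; lia. Qed.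

(** This is d_r <= r k for r = n - i, where n is the length of [S]. *)
Lemma excess_take_append_block i :
  (size Q < i <= size S)%N -> L%:Z <= excess k (take i S).
Proof.
move=> lt_i; rewrite /excess last_take ?size_takel; try lia.
rewrite nth_append_block //.
have /nth_code_le : (size S - i < num_internal A)%N.
  by rewrite size_append_block in lt_i *; lia.
have : (i * k <= size S * k)%N by rewrite leq_mul2r; lia.
by rewrite mulnBl; lia.
Qed.

(** Prefixes longer than [Q] have excess at least [L], while a nonempty [Q] has excess below [L]. *)
Lemma cut_append_block : cut_index k S = size Q.
Proof.
apply: cut_indexE; split=> [|Q_gt0|i lt_i]; first by rewrite size_append_block; lia.
  rewrite take_size_cat // excess_append_block.
  by case: aQ => _ _; apply; rewrite -size_eq0 -lt0n.
by rewrite excess_append_block; apply: excess_take_append_block.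
Qed.

Lemma first_tree_append_block : first_tree k S = A.
Proof.
apply/first_treeE/is_first_treeP; rewrite cut_append_block drop_size_cat //.
by rewrite last_append_block size_append_block -size_code /block map_rev revK.
Qed.

Lemma admissible_append_block : admissible L.+1 S.
Proof.
have [sQ ge0 ltL] := aQ; split=> [|i lt_i|_]; last by rewrite excess_append_block; lia.
  rewrite lt_sorted_pairwise pairwise_cat -!lt_sorted_pairwise sQ /=.
  apply/andP; split; last first.
    rewrite sorted_map rev_sorted; apply: sub_sorted (sorted_code A) => x y /=; lia.
  (* With m internal nodes, d_r <= r k <= m k, so a block entry is at least k |Q| + L, which exceeds
     the last term of [Q]. *)
  apply/allrelP => x y Qx /mapP[d]; rewrite mem_rev => /(nthP 0%N)[r].
  rewrite size_code => lt_r <- ->; have le_x := sorted_le_last sQ Qx.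
  have Q_neq0 : Q != [::] by case: (Q) Qx.
  have := ltL Q_neq0; have := nth_code_le lt_r.
  have : (r * k <= num_internal A * k)%N by rewrite leq_mul2r ltnW ?orbT.
  rewrite /excess mulnDr.
  by move: (last 0 Q) le_x (nth 0%N (code A) r) (k * size Q)%N => w; lia.
have [le_i|lt_iQ] := leqP i (size Q).
  by rewrite takel_cat //; apply: ge0; lia.
have := @excess_take_append_block i; lia.
Qed.

End AppendBlock.

(** A trivial tree appends nothing and sits at a position that no cut prefix reaches; a nontrivial
    one is recovered as the first tree, and cutting gives back the earlier sequence. *)
Lemma join_treesP T :
  admissible (size T) (join_trees T) /\ coordinates (size T) (join_trees T) = T.
Proof.
elim: T => [|A T [aT eqT]] /=; first by split=> //; split=> // -[|i].
set Q := join_trees T in aT eqT *.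
have [A0|A_gt0] := posnP (num_internal A).
  have -> : A = Trivial by case: A A0.
  rewrite block_trivial cats0 coordinatesS eqT (coordinate_large aT) //; split=> //.
  by case: aT => sQ ge0 ltL; split=> // /ltL; lia.
have aS := admissible_append_block aT A_gt0; split=> //.
rewrite coordinatesS; set S := Q ++ _ in aS *.
have S_neq0 : S != [::] by rewrite -size_eq0 size_append_block; lia.
rewrite coordinate_cons // excess_append_block // eqxx first_tree_append_block //.
congr cons; rewrite -[RHS]eqT; apply/eq_in_map => j.
rewrite mem_rev mem_iota => lt_j; rewrite coordinate_cons // excess_append_block //.
case: eqP => [|_]; first by lia.
by rewrite cut_append_block // take_size_cat.
Qed.

(** * Threshold sequences as admissible sequences *)

Lemma thresholdP (l n : nat) S :
  (0 < n)%N -> threshold k l%:Z n S <-> size S = n /\ admissible l.+1 S.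
Proof.
move=> n_gt0; split=> [/and3P[/eqP szS sS /forallP bS]|[szS [sS ge0 ltl]]].
  have {}bS i : (0 < i <= n)%N -> (k * i)%:Z <= S`_i.-1 <= (k * n)%:Z + l%:Z.
    by case: i => // i lt_i; have := bS (Ordinal lt_i).
  split=> //; split=> // [i|_].
    rewrite szS => lt_i; have := bS i lt_i.
    by rewrite /excess last_take ?size_takel ?szS //; lia.
  have := bS n; rewrite n_gt0 leqnn => /(_ isT).
  by rewrite -szS nth_last /excess; lia.
have S_neq0 : S != [::] by rewrite -size_eq0 szS -lt0n.
apply/and3P; split=> //; first exact/eqP.
apply/forallP => i; have lt_i := ltn_ord i.
have := ge0 i.+1; rewrite szS => /(_ lt_i); rewrite /excess last_take ?szS //=.
rewrite size_takel ?szS // => ge0i.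
have lt_e := ltl S_neq0.
(* By monotonicity, the upper bound on the last term bounds every term. *)
have := sorted_le_last sS (mem_nth 0 (_ : (i < size S)%N)).
rewrite szS => /(_ lt_i); move: lt_e ge0i; rewrite /excess szS.
by move: S`_i (last 0 S) (k * i.+1)%N (k * n)%N; lia.
Qed.

Lemma proper_threshold_excess L S (l' : int) :
  admissible L S -> S != [::] ->
  proper_threshold k l' (size S) S <-> l' = excess k S.
Proof.
move=> aS S_neq0; split=> [/andP[_ /eqP lastS]|->]; first by rewrite /excess lastS; lia.
(* [thresholdP] takes a natural bound, so the nonnegative excess is replaced by [e]. *)
have := excess_ge0 aS S_neq0; case eq_e: (excess k S) => [e|//] _.
apply/andP; split; last by apply/eqP; move: eq_e; rewrite /excess; lia.
apply/thresholdP; first by rewrite lt0n size_eq0.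
by case: aS => sS ge0 _; split=> //; split=> // _; rewrite eq_e; lia.
Qed.

Lemma cut_prefixes_admissible L S :
  admissible L S -> {in cut_prefixes k S, forall Q, admissible L Q /\ Q != [::]}.
Proof.
have [m] := ubnP (size S); elim: m S => // m IH S lt_Sm aS.
have [->//|S_neq0] := eqVneq S [::]; have [lt_c _ _] := cut_indexP S_neq0.
move=> Q; rewrite cut_prefixes_cons // inE => /predU1P[->//|].
apply: IH; first by rewrite size_takel; lia.
by apply: (admissible_cut aS S_neq0); case: aS => _ _ /(_ S_neq0)/ltW.
Qed.

(** The cut prefix is admissible for the excess [e] of [S] itself, so [e] cannot recur later; this
    is why [L] varies in the induction. *)
Lemma uniq_excess L S :
  admissible L S -> uniq [seq excess k Q | Q <- cut_prefixes k S].
Proof.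
have [m] := ubnP (size S); elim: m L S => // m IH L S lt_Sm aS.
have [->//|S_neq0] := eqVneq S [::]; have [lt_c _ _] := cut_indexP S_neq0.
have := excess_ge0 aS S_neq0; case eq_e: (excess k S) => [e|//] _.
have aS' : admissible e (take (cut_index k S) S).
  by apply: admissible_cut aS S_neq0 _; rewrite eq_e.
rewrite cut_prefixes_cons //= eq_e (IH e) //; last by rewrite size_takel; lia.
rewrite andbT; apply/mapP => -[Q /(cut_prefixes_admissible aS')[[_ _ ltQ] /ltQ]].
by move=> + eqQ; rewrite -eqQ ltxx.
Qed.

Lemma ForestTuple_coordinates l S :
  ForestTuple k l S = rev (coordinates l.+1 S) :> seq (ktree k).
Proof.
rewrite /coordinates map_rev revK -val_enum_ord -map_comp.
by apply: eq_map.
Qed.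

End Cutting.

Local Close Scope ring_scope.

Theorem theorem3p6 (n k l : nat)
    (hn : (1 <= n)%N) (hk : (2 <= k)%N) (hl : (l <= k - 2)%N) :
  ForestTuple_well_defined k l n /\
  set_bij [set S : seq int | threshold k l%:Z n S]%classic
          [set T : l.+1.-tuple (ktree k) |
             (\sum_(A <- T) num_internal A)%N = n]%classic
          (ForestTuple k l).
Proof.
split.
  move=> S /thresholdP[//|_ aS].
  have aQ := cut_prefixes_admissible aS; split; last exact: uniq_excess aS.
    move=> Q /aQ[[sQ _ _] Q_neq0]; exists (first_tree k Q).
    split; first exact: first_tree_exists.
    by move=> A; apply: is_first_tree_inj; apply: first_tree_exists.
  move=> Q /aQ[aQQ Q_neq0]; split=> [l'|].
    exact: proper_threshold_excess aQQ Q_neq0.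
  by rewrite (excess_ge0 aQQ) //; case: aQQ => _ _ /(_ Q_neq0); lia.
(* A left inverse of [ForestTuple]: it yields injectivity and, through the length of [join_trees],
   the total number of internal nodes. *)
have joinK S : threshold k l%:Z n S -> join_trees (rev (ForestTuple k l S)) = S.
  by move=> /thresholdP[//|_ aS]; rewrite ForestTuple_coordinates revK join_coordinates.
split=> [S /= thS|S S' thS thS' eqS|T /= sumT].
- rewrite -(perm_big _ (permEl (perm_rev _))) /= -size_join_trees joinK //.
  by case/thresholdP: thS.
- by rewrite -(joinK S (set_mem thS)) eqS joinK //; exact: set_mem thS'.
(* For surjectivity, the reversal passes to the decreasing order of positions used by
   [join_trees]. *)
have := join_treesP (rev T); rewrite size_rev size_tuple => -[aT eqT].
exists (join_trees (rev T)); last first.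
  by apply: val_inj; rewrite /= ForestTuple_coordinates eqT revK.
apply/thresholdP => //; split=> //.
by rewrite size_join_trees (perm_big _ (permEl (perm_rev _))).
Qed.
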